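(* For every $1<p<\infty$, the space $\ell_p$ (over $\mathbb{K}$, with its standard norm) has the property (SL).
   Context: $\mathbb{K}$ is $\mathbb{R}$ or $\mathbb{C}$. A normed space is smooth if each nonzero vector $x$ has a unique supporting functional $\varphi_x$, i.e. a linear functional with $\|\varphi_x\|=1$ and $\varphi_x(x)=\|x\|$; $\ell_p$ is smooth for $1<p<\infty$. A semi-inner product on a normed space $X$ over $\mathbb{K}$ (in the sense of Lumer–Giles, generating the norm) is a map $[\cdot|\cdot]:X\times X\to\mathbb{K}$ such that for all $x,y,z\in X$ and $\alpha,\beta,\lambda\in\mathbb{K}$: $[\alpha x+\beta y|z]=\alpha[x|z]+\beta[y|z]$; $[x|\lambda y]=\overline{\lambda}[x|y]$; $|[x|y]|\le\|x\|\,\|y\|$; $[x|x]=\|x\|^2$. On a smooth space it exists and is unique, and is given by $[x|y]=\|y\|\varphi_y(x)$, where $\varphi_0:=0$. A smooth normed space $X$ has the property (SL) if every mapping $f:X\to X$ (not assumed linear, continuous or surjective) satisfying $[f(x)|f(y)]=[x|y]$ for all $x,y\in X$ is linear. *)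

(* Defs.v *)
From HB Require Import structures.
From mathcomp Require Import all_boot all_order all_algebra.
From mathcomp Require Import all_classical all_reals all_analysis.
From mathcomp Require Import complex.

Set Implicit Arguments.
Unset Strict Implicit.
Unset Printing Implicit Defensive.

Import Order.TTheory GRing.Theory Num.Theory.
Import numFieldNormedType.Exports.

Local Open Scope classical_set_scope.
Local Open Scope ring_scope.

Section semi_inner_products.
Context (K : numFieldType) (conj : K -> K) (X : normedModType K).

(* The norm of X takes its values in K (for K = R[i], on the nonnegative real
   axis).  R[i] is only partially ordered, and u <= v there means that v - u is
   a nonnegative real, so this is the usual supremum of a set of reals. *)
Definition is_dual_norm (phi : X -> K) (c : K) : Prop :=
  isLub [set `|phi x| | x in [set x : X | `|x| <= 1]] c.

Definition supporting_functional (x : X) (phi : X -> K) : Prop :=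
  [/\ scalar phi, is_dual_norm phi 1 & phi x = `|x|].

Definition smooth : Prop :=
  forall x : X, x != 0 -> exists! phi : X -> K, supporting_functional x phi.

Record semi_inner_product (s : X -> X -> K) : Prop := SemiInnerProduct {
  sip_linear : forall (a b : K) (x y z : X),
    s (a *: x + b *: y) z = a * s x z + b * s y z ;
  sip_conj : forall (l : K) (x y : X), s x (l *: y) = conj l * s x y ;
  sip_bound : forall x y : X, `|s x y| <= `|x| * `|y| ;
  sip_norm : forall x : X, s x x = `|x| ^+ 2 }.

(* A smooth space carries exactly one semi-inner product, so quantifying over
   all of them refers to that one, and is not vacuous. *)
Definition property_SL : Prop :=
  smooth /\
  forall s : X -> X -> K, semi_inner_product s ->
  forall f : X -> X, (forall x y, s (f x) (f y) = s x y) -> linear f.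

End semi_inner_products.

Variant scalar_kind := RealScalars | ComplexScalars.

Definition scalars (R : realType) (k : scalar_kind) : numFieldType :=
  match k with RealScalars => R | ComplexScalars => R[i] end.

Definition scalar_conj (R : realType) (k : scalar_kind) :
    scalars R k -> scalars R k :=
  match k with RealScalars => id | ComplexScalars => @conjc R end.

Definition of_real (R : realType) (k : scalar_kind) : R -> scalars R k :=
  match k with RealScalars => id | ComplexScalars => real_complex R end.

Definition modulus (R : realType) (k : scalar_kind) : scalars R k -> R :=
  match k with RealScalars => Num.norm | ComplexScalars => @Normc.normc R end.

Section scalars_theory.
Context (R : realType) (k : scalar_kind).
Implicit Types (z w : scalars R k) (r s : R).

Lemma of_real_modulus z : of_real k (modulus z) = `|z|.
Proof. by case: k z. Qed.

Lemma of_realD r s : of_real k (r + s) = of_real k r + of_real k s.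
Proof. by case: k => //=; rewrite rmorphD. Qed.

Lemma of_realM r s : of_real k (r * s) = of_real k r * of_real k s.
Proof. by case: k => //=; rewrite rmorphM. Qed.

Lemma of_real0 : of_real k 0 = 0 :> scalars R k.
Proof. by case: k. Qed.

Lemma of_real_inj : injective (@of_real R k).
Proof. by case: k => //=; exact: complexI. Qed.

Lemma ler_of_real r s : (of_real k r <= of_real k s) = (r <= s).
Proof. by case: k => //=; rewrite lecR. Qed.

Lemma modulus_ge0 z : 0 <= modulus z.
Proof. by rewrite -ler_of_real of_real0 of_real_modulus. Qed.

Lemma modulusM z w : modulus (z * w) = modulus z * modulus w.
Proof. by apply: of_real_inj; rewrite of_realM !of_real_modulus normrM. Qed.

Lemma ler_modulusD z w : modulus (z + w) <= modulus z + modulus w.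
Proof. by rewrite -ler_of_real of_realD !of_real_modulus ler_normD. Qed.

Lemma modulus0 : modulus (0 : scalars R k) = 0.
Proof. by apply: of_real_inj; rewrite of_real_modulus of_real0 normr0. Qed.

Lemma modulus0_eq0 z : modulus z = 0 -> z = 0.
Proof.
by move=> z0; apply/normr0_eq0; rewrite -of_real_modulus z0 of_real0.
Qed.

End scalars_theory.

Section lp_sequences.
Context (R : realType) (k : scalar_kind) (p : R).
Local Notation K := (scalars R k).
Implicit Types x y : nat -> K.

Definition lp_series x : nat -> R := series (fun n => modulus (x n) `^ p).

Definition lp_pred : {pred nat -> K} := fun x => `[< cvgn (lp_series x) >].

Definition lp_norm x : R := limn (lp_series x) `^ p^-1.

Hypothesis p1 : 1 <= p.

Let p_gt0 : 0 < p. Proof. exact: lt_le_trans p1. Qed.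

Let lp_eseriesE x : cvgn (lp_series x) ->
  (\sum_(n <oo) (modulus (x n) `^ p)%:E = (limn (lp_series x))%:E)%E.
Proof.
move=> cx; rewrite -EFin_lim//; congr (limn _); apply/funext => n /=.
by rewrite sumEFin.
Qed.

Let Lnorm_modulusE x :
  'N[counting]_p%:E[EFin \o (@modulus R k \o x)]%E =
  ((\sum_(n <oo) (modulus (x n) `^ p)%:E) `^ p^-1)%E.
Proof.
rewrite Lnorm_counting//; congr (poweR _ _); apply: eq_eseriesr => n _ /=.
by rewrite ger0_norm ?modulus_ge0.
Qed.

Lemma Lnorm_lp_norm x : x \in lp_pred ->
  'N[counting]_p%:E[EFin \o (@modulus R k \o x)]%E = (lp_norm x)%:E.
Proof. by move=> /asboolP cx; rewrite Lnorm_modulusE lp_eseriesE. Qed.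

Lemma lp_pred_Lnorm_lty x :
  ('N[counting]_p%:E[EFin \o (@modulus R k \o x)] < +oo)%E -> x \in lp_pred.
Proof.
rewrite Lnorm_modulusE => xoo; apply/asboolP/nnseries_is_cvg => [n|].
  exact: powR_ge0.
by apply: lty_poweRy xoo; rewrite invr_neq0// gt_eqF.
Qed.

Let Lnorm_modulusD x y :
  ('N[counting]_p%:E[EFin \o (@modulus R k \o (x + y)%R)] <=
   'N[counting]_p%:E[EFin \o (@modulus R k \o x)] +
   'N[counting]_p%:E[EFin \o (@modulus R k \o y)])%E.
Proof.
apply: le_trans (minkowski_EFin counting _ _ p1) => //.
rewrite !Lnorm_counting//; apply: gt0_ler_poweR.
- by rewrite invr_ge0 ltW.
- by rewrite in_itv/= leey andbT nneseries_ge0// => n _ _; exact: poweR_ge0.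
- by rewrite in_itv/= leey andbT nneseries_ge0// => n _ _; exact: poweR_ge0.
apply: lee_nneseries => n _ /=; first by rewrite lee_fin powR_ge0.
rewrite lee_fin ge0_ler_powR ?nnegrE ?normr_ge0 ?(ltW p_gt0)//.
by rewrite !ger0_norm ?addr_ge0 ?modulus_ge0//; exact: ler_modulusD.
Qed.

Let lp_seriesZ (a : K) x : lp_series (a *: x) = modulus a `^ p *: lp_series x.
Proof.
apply/funext => n; transitivity (modulus a `^ p * lp_series x n) => //.
rewrite /lp_series /series/= mulr_sumr; apply: eq_bigr => i _.
by rewrite [(a *: x) i]/(a * x i) modulusM powRM ?modulus_ge0.
Qed.

Let lp_predZ (a : K) x : x \in lp_pred -> a *: x \in lp_pred.
Proof.
by move=> /asboolP cx; apply/asboolP; rewrite lp_seriesZ; exact: is_cvgZl_tmp.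
Qed.

Let lp_predD x y : x \in lp_pred -> y \in lp_pred -> x + y \in lp_pred.
Proof.
move=> lx ly; apply: lp_pred_Lnorm_lty.
by rewrite (le_lt_trans (Lnorm_modulusD x y))// !Lnorm_lp_norm// ltry.
Qed.

Lemma lp_submod_closed : submod_closed lp_pred.
Proof.
split=> [|a x y lx ly]; last exact: lp_predD (lp_predZ a lx) ly.
have -> : (0 : nat -> K) = 0 *: (0 : nat -> K) by rewrite scale0r.
apply/asboolP; rewrite lp_seriesZ modulus0 powR0 ?gt_eqF// scale0r.
exact: is_cvg_cst.
Qed.

Lemma ler_lp_normD x y : x \in lp_pred -> y \in lp_pred ->
  lp_norm (x + y) <= lp_norm x + lp_norm y.
Proof.
move=> lx ly; have lxy := lp_predD lx ly.
have := Lnorm_modulusD x y.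
rewrite (Lnorm_lp_norm lxy) (Lnorm_lp_norm lx) (Lnorm_lp_norm ly).
by rewrite -EFinD lee_fin.
Qed.

Lemma lp_normZ (a : K) x : x \in lp_pred ->
  lp_norm (a *: x) = modulus a * lp_norm x.
Proof.
move=> /asboolP cx; rewrite /lp_norm lp_seriesZ limZl_tmp// [_ *: _]/(_ * _).
rewrite powRM ?powR_ge0// -?powRrM ?mulfV ?gt_eqF// ?powRr1 ?modulus_ge0//.
apply: limr_ge => //; apply: nearW => n; apply: sumr_ge0 => i _.
exact: powR_ge0.
Qed.

Lemma lp_norm0_eq0 x : x \in lp_pred -> lp_norm x = 0 -> x = 0.
Proof.
move=> /asboolP cx /powR_eq0_eq0 x0; apply/funext => n; apply: modulus0_eq0.
apply: (@powR_eq0_eq0 _ _ p); apply/eqP; rewrite eq_le powR_ge0 andbT.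
have nd : nondecreasing_seq (lp_series x).
  by apply: nondecreasing_series => i _ _; exact: powR_ge0.
rewrite -x0 (le_trans _ (nondecreasing_cvgn_le nd cx n.+1))//.
rewrite /lp_series seriesSr lerDr.
by apply: sumr_ge0 => i _; exact: powR_ge0.
Qed.

End lp_sequences.

(* The exponent bound is a parameter of the type: it is what makes lp_norm a
   norm. *)
Record lp (R : realType) (k : scalar_kind) (p : R) (p1 : 1 <= p) := Lp {
  lp_seq :> nat -> scalars R k ;
  lp_seqP : lp_seq \in @lp_pred R k p }.

Section lp_space.
Context (R : realType) (k : scalar_kind) (p : R) (p1 : 1 <= p).

HB.instance Definition _ :=
  GRing.isSubmodClosed.Build _ _ (@lp_pred R k p) (lp_submod_closed k p1).

HB.instance Definition _ := [isSub for @lp_seq R k p p1].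
HB.instance Definition _ := [Choice of lp k p1 by <:].
HB.instance Definition _ := [SubChoice_isSubLmodule of lp k p1 by <:].

Let nm (x : lp k p1) : scalars R k := of_real k (lp_norm p x).

Let ler_nmD (x y : lp k p1) : nm (x + y) <= nm x + nm y.
Proof.
by rewrite /nm -of_realD ler_of_real; apply: ler_lp_normD => //; exact: lp_seqP.
Qed.

Let nmZ (a : scalars R k) (x : lp k p1) : nm (a *: x) = `|a| * nm x.
Proof.
rewrite /nm -of_real_modulus -of_realM; congr (of_real _ _).
by apply: lp_normZ => //; exact: lp_seqP.
Qed.

Let nm0_eq0 (x : lp k p1) : nm x = 0 -> x = 0.
Proof.
rewrite /nm -(of_real0 R k) => /of_real_inj x0; apply: val_inj.
by apply: lp_norm0_eq0 x0 => //; exact: lp_seqP.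
Qed.

HB.instance Definition _ :=
  Lmodule_isNormed.Build (scalars R k) (lp k p1) ler_nmD nmZ nm0_eq0.

Lemma lp_normE (x : lp k p1) : `|x| = of_real k (lp_norm p x).
Proof. by []. Qed.

End lp_space.

(* Main.v *)
Require Import Defs.
From mathcomp Require Import all_boot all_order all_algebra.
From mathcomp Require Import all_classical all_reals all_analysis.
From mathcomp Require Import complex ring lra.

Import Order.TTheory GRing.Theory Num.Theory numFieldNormedType.Exports.
Local Open Scope ring_scope.

(** Write [dual_point p w] for the scalar |w|^(p-2) conj(w) and [pairing x y]
    for the real part of the sum of x_n * dual_point p (y_n).  Up to the factor
    ||y||^(p-2) this is the real part of the semi-inner product [x|y], and the
    real part of a functional determines the functional, so the whole argument
    is about a map f with

      pairing (a f(x)) (b f(y)) = pairing (a x) (b y)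

    for all scalars a, b; in particular f preserves the norm.  The single
    inequality behind almost everything is the scalar one,

      p Re(z dual_point p w) <= |z|^p + (p-1) |w|^p,  equality iff z = w,

    whose defect is called [power_gap].  Summed over the coordinates, it gives
    Hoelder's inequality and its equality case.

    Smoothness.  If phi supports x, compare phi(x + t y) <= ||x + t y|| with
    the summed inequality: for t > 0 this yields
    ||x||^(p-1) Re phi(y) <= pairing y (x + t y).  For y = a e_n only one
    coordinate moves and t -> 0 identifies phi on e_n; density of the finitely
    supported sequences does the rest.  So [pairing _ x], suitably normalised,
    is the only supporting functional, and it computes every semi-inner
    product ([sip_pairing]).

    Linearity for p <> 2.  The images f(e_n), f(e_m) with n <> m have disjoint
    supports.  For p < 2, pairing f(e_n) + f(e_m) and f(e_n) - f(e_m) with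
    f(e_n + e_m) and f(e_n - e_m) shows that both have p-th power norm at least
    2, while Clarkson's inequality bounds the sum of the two by 4, with
    equality only for disjoint supports.  For p > 2 Clarkson's inequality goes
    the wrong way, but the same computation applies to the dual sequences of
    f(e_n) and f(e_m), whose exponent p/(p-1) is below 2.

    Knowing this, put z = f(x) and add up the gaps between z and x_n f(e_n)
    over the supports of the f(e_n), n < N, together with |z|^p off these
    supports.  The pairing identity turns the total into ||x||^p minus the sum
    of |x_n|^p for n < N, which tends to 0.  All the terms are nonnegative,
    hence they vanish: z equals x_n f(e_n) on the support of f(e_n), and 0 off
    all these supports.  That description of f(x) is linear in x.

    Linearity for p = 2.  Here the pairing is additive in its second argument
    as well, and u = f(a x + y) - a f(x) - f(y) is orthogonal to every f(z),
    hence to itself. *)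

(** * The scalars, real or complex *)

Section scalars.
Local Set Implicit Arguments.
Local Unset Strict Implicit.
Context {R : realType} {k : scalar_kind}.
Local Notation K := (scalars R k).
Local Notation conj := (@scalar_conj R k).
Implicit Types (z w : K) (r : R).

Definition re_part : K -> R :=
  match k with RealScalars => id | ComplexScalars => @complex.Re R end.

Lemma re_partD z w : re_part (z + w) = re_part z + re_part w.
Proof. by rewrite /re_part; case: k z w => //= -[a b] [c d]. Qed.

Lemma re_partN z : re_part (- z) = - re_part z.
Proof. by rewrite /re_part; case: k z => //= -[a b]. Qed.

Lemma re_partZ r z : re_part (of_real k r * z) = r * re_part z.
Proof. by rewrite /re_part; case: k z => //= -[a b]; simpc. Qed.

Lemma re_part_of_real r : re_part (of_real k r) = r.
Proof. by rewrite /re_part; case: k. Qed.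

Lemma re_part_le_modulus z : re_part z <= modulus z.
Proof.
rewrite /re_part; case: k z => [z|[a b]] /=; first exact: ler_norm.
rewrite (le_trans (ler_norm _))// -sqrtr_sqr ler_sqrt ?addr_ge0 ?sqr_ge0//.
by rewrite lerDl sqr_ge0.
Qed.

Lemma modulusN z : modulus (- z) = modulus z.
Proof. by apply: (@of_real_inj R k); rewrite !of_real_modulus normrN. Qed.

Lemma normr_re_part z : `|re_part z| <= modulus z.
Proof.
rewrite ler_norml re_part_le_modulus andbT lerNl -re_partN -(modulusN z).
exact: re_part_le_modulus.
Qed.

Lemma of_real1 : of_real k 1 = 1 :> K.
Proof. by case: k. Qed.

Lemma of_realN1 : of_real k (-1) = -1 :> K.
Proof. by case: k => //=; rewrite rmorphN1. Qed.

Lemma mulr_conj z : z * conj z = of_real k (modulus z ^+ 2).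
Proof.
case: k z => [z|[a b]] /=; first by rewrite real_normK ?num_real// expr2.
rewrite sqr_sqrtr ?addr_ge0 ?sqr_ge0//; apply/eqP; rewrite eq_complex/=.
by apply/andP; split; apply/eqP; ring.
Qed.

Lemma modulus_conj z : modulus (conj z) = modulus z.
Proof. by case: k z => [z|[a b]] //=; rewrite sqrrN. Qed.

Lemma modulus_of_real r : modulus (of_real k r) = `|r|.
Proof. by case: k => //=; rewrite expr0n/= addr0 sqrtr_sqr. Qed.

Lemma conjD z w : conj (z + w) = conj z + conj w.
Proof.
case: k z w => //= -[a b] [c d]; apply/eqP; rewrite eq_complex/=.
by rewrite opprD !eqxx.
Qed.

Lemma conj_realM r z : conj (of_real k r * z) = of_real k r * conj z.
Proof. by case: k z => //= -[a b]; simpc. Qed.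

Lemma re_part_eq_modulus z : re_part z = modulus z -> z = of_real k (modulus z).
Proof.
rewrite /re_part; case: k z => [z|[a b]] //= aE.
have b0 : b = 0.
  apply/eqP; rewrite -sqrf_eq0; apply/eqP.
  have := sqr_sqrtr (addr_ge0 (sqr_ge0 a) (sqr_ge0 b)).
  by rewrite -aE; lra.
by rewrite -aE b0.
Qed.

Lemma modulus_parallelogram z w :
  modulus (z + w) ^+ 2 + modulus (z - w) ^+ 2 =
  2 * (modulus z ^+ 2 + modulus w ^+ 2).
Proof.
case: k z w => [z w|[a b] [c d]] /=.
  by rewrite !real_normK ?num_real//; ring.
by rewrite !sqr_sqrtr ?addr_ge0 ?sqr_ge0//; ring.
Qed.

Lemma re_part_nondegenerate z : (forall w, re_part (w * z) = 0) -> z = 0.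
Proof.
move=> /(_ (conj z)); rewrite mulrC mulr_conj re_part_of_real => /eqP.
by rewrite sqrf_eq0 => /eqP/modulus0_eq0.
Qed.

(** In the complex case the functional is u |-> r(u) - i r(i u).  It lets every
    K-valued functional below be handled through its real part, so that only
    real series are ever summed. *)
Lemma re_functional_extends (V : lmodType K) (r : V -> R) :
  (forall u v, r (u + v) = r u + r v) ->
  (forall t u, r (of_real k t *: u) = t * r u) ->
  exists2 phi : V -> K, scalar phi & forall u, re_part (phi u) = r u.
Proof.
rewrite /re_part; case: k V r => [V r rD rZ|V r rD rZ] /=.
  by exists r => // a u v; rewrite rD rZ.
exists (fun u => (r u +i* - r ('i%C *: u))%C) => //.
move=> [a b] u v; rewrite rD !scalerDr rD.
have -> : (a +i* b)%C = (a%:C + b%:C * 'i)%C :> R[i].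
  by apply/eqP; rewrite eq_complex/=; apply/andP; split; apply/eqP; ring.
have -> : r ('i%C *: ((a%:C + b%:C * 'i)%C *: u)) = a * r ('i%C *: u) - b * r u.
  rewrite scalerA mulrDr mulrCA -expr2 sqr_i mulrN1 scalerDl rD.
  rewrite mulrC -scalerA rZ.
  by congr (_ + _); rewrite -[(- b%:C)%C](rmorphN (real_complex R)) rZ mulNr.
rewrite scalerDl rD -!scalerA !rZ; apply/eqP; rewrite eq_complex/=.
by apply/andP; split; apply/eqP; ring.
Qed.

End scalars.

(** * Inequalities between real powers *)

Section powers.
Local Set Implicit Arguments.
Local Unset Strict Implicit.
Context {R : realType}.
Implicit Types a b p r : R.

(* This is the inequality of [young_powR] for a / b = expR x, divided by
   b ^ p * expR x; it only needs the tangent of the exponential at 0. *)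
Let young_expR p (x : R) : 1 < p -> x != 0 ->
  p < expR ((p - 1) * x) + (p - 1) * expR (- x).
Proof.
move=> p1 x0.
have h1 : 1 + (p - 1) * x <= expR ((p - 1) * x) by exact: expR_ge1Dx.
have h2 : 1 + - x < expR (- x) by rewrite expR_gt1Dx ?oppr_eq0.
nra.
Qed.

(** Weighted AM-GM inequality, with its equality case in contrapositive form. *)
Lemma young_powR p a b : 1 < p -> 0 <= a -> 0 <= b -> a != b ->
  p * (a * b `^ (p - 1)) < a `^ p + (p - 1) * b `^ p.
Proof.
move=> p1 a0 b0 ab.
have p0 : 0 < p by lra.
have [aE|an0] := eqVneq a 0.
  have bn0 : b != 0 by rewrite eq_sym -aE.
  rewrite aE mul0r mulr0 powR0 ?gt_eqF// add0r mulr_gt0 ?subr_gt0//.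
  by rewrite powR_gt0// lt_neqAle eq_sym bn0.
have [bE|bn0] := eqVneq b 0.
  rewrite bE !powR0 ?gt_eqF ?subr_gt0// !mulr0 addr0.
  by rewrite powR_gt0// lt_neqAle eq_sym an0.
have {}a0 : 0 < a by rewrite lt_neqAle eq_sym an0.
have {}b0 : 0 < b by rewrite lt_neqAle eq_sym bn0.
pose x := ln (a / b).
have aE : a = b * expR x by rewrite lnK ?posrE ?divr_gt0// mulrCA divff// mulr1.
have x0 : x != 0.
  by apply: contraNneq ab => x0; rewrite aE x0 expR0 mulr1.
have eN : expR x * expR (- x) = 1 by rewrite -expRD subrr expR0.
rewrite {2}aE powRM ?expR_ge0 1?ltW// -expRM -(mulr_powRB1 (ltW b0) p0).
have -> : x * p = x + (p - 1) * x by ring.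
rewrite expRD aE.
have := young_expR p1 x0.
have : 0 < b * b `^ (p - 1) * expR x by rewrite !mulr_gt0 ?expR_gt0 ?powR_gt0.
move: eN; set E := expR x; set F := expR (- x); set G := expR _.
move: (b `^ _) => C eN.
move=> /ltr_pM2l <-; congr (_ < _); first by ring.
rewrite mulrDr [X in _ + X](_ : _ = (p - 1) * (b * C) * (E * F)); last by ring.
by rewrite eN; ring.
Qed.

Lemma young_powR_le p a b : 1 < p -> 0 <= a -> 0 <= b ->
  p * (a * b `^ (p - 1)) <= a `^ p + (p - 1) * b `^ p.
Proof.
move=> p1 a0 b0; have [->|ab] := eqVneq a b; last exact/ltW/young_powR.
by rewrite mulr_powRB1//; [lra|lra].
Qed.

(** Strict monotonicity of the l_r norms in r, on two coordinates: factor
    s `^ (r / 2) as s * s `^ (r / 2 - 1) with s = x ^+ 2 + y ^+ 2, and use that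
    the second factor decreases with s. *)
Lemma powR_add_lt r (x y : R) : 0 < r < 2 -> 0 < x -> 0 < y ->
  (x ^+ 2 + y ^+ 2) `^ (r / 2) < x `^ r + y `^ r.
Proof.
move=> /andP[r0 r2] x0 y0.
have s0 : 0 < x ^+ 2 + y ^+ 2 by rewrite addr_gt0 ?exprn_gt0.
have part (a b : R) : 0 < a -> 0 < b ->
    a ^+ 2 * (a ^+ 2 + b ^+ 2) `^ (r / 2 - 1) < a `^ r.
  move=> a0 b0.
  have -> : a `^ r = a ^+ 2 * (a ^+ 2) `^ (r / 2 - 1).
    rewrite mulr_powRB1 ?exprn_ge0 1?ltW ?divr_gt0//.
    rewrite -powR_mulrn 1?ltW// -powRrM; congr (_ `^ _).
    by rewrite mulrCA divff// mulr1.
  rewrite ltr_pM2l ?exprn_gt0//.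
  have -> : r / 2 - 1 = - (1 - r / 2) by ring.
  rewrite !powRN ltf_pV2 ?posrE ?powR_gt0 ?addr_gt0 ?exprn_gt0//.
  by apply: gt0_ltr_powR; rewrite ?nnegrE ?addr_ge0 ?exprn_ge0 1?ltW//;
    [lra|rewrite ltrDl exprn_gt0].
rewrite -(@mulr_powRB1 _ (x ^+ 2 + y ^+ 2)) ?(ltW s0) ?divr_gt0// mulrDl.
by rewrite ltrD ?part// [x ^+ 2 + _]addrC part.
Qed.

End powers.

(** * The duality map and Clarkson's inequality on scalars *)

Section pointwise.
Local Set Implicit Arguments.
Local Unset Strict Implicit.
Context {R : realType} {k : scalar_kind}.
Local Notation K := (scalars R k).
Local Notation conj := (@scalar_conj R k).
Implicit Types (z w c : K) (p r : R).

(** The derivative of |w| ^ p / p: the map z |-> Re (z * dual_point p w) is the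
    differential at w of that function. *)
Definition dual_point p w : K := of_real k (modulus w `^ (p - 2)) * conj w.

Lemma powR_subr2 p z : 1 < p ->
  modulus z `^ (p - 2) * modulus z = modulus z `^ (p - 1).
Proof.
move=> p1; rewrite -(@mulr_powRB1 _ _ (p - 1)) ?modulus_ge0 ?subr_gt0// mulrC.
by congr (_ * _ `^ _); ring.
Qed.

Lemma re_mul_dual_self p w : 1 < p ->
  re_part (w * dual_point p w) = modulus w `^ p.
Proof.
move=> p1; rewrite /dual_point mulrCA mulr_conj -of_realM re_part_of_real.
rewrite expr2 mulrA powR_subr2// mulrC mulr_powRB1 ?modulus_ge0//.
exact: lt_trans p1.
Qed.

Lemma modulus_dual_point p w : 1 < p ->
  modulus (dual_point p w) = modulus w `^ (p - 1).
Proof.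
move=> p1; rewrite /dual_point modulusM modulus_of_real modulus_conj.
by rewrite ger0_norm ?powR_ge0// powR_subr2.
Qed.

Lemma dual_point0 p : dual_point p (0 : K) = 0.
Proof.
apply: modulus0_eq0.
by rewrite /dual_point modulusM modulus_conj modulus0 mulr0.
Qed.

Lemma dual_pointN p z : dual_point p (- z) = - dual_point p z.
Proof.
by rewrite /dual_point modulusN -[- z]mulN1r -of_realN1 conj_realM of_realN1
  mulN1r mulrN.
Qed.

Lemma dual_point_eq0 p w : 1 < p -> dual_point p w = 0 -> w = 0.
Proof.
move=> p1 w0; apply: modulus0_eq0; apply: (@powR_eq0_eq0 _ _ (p - 1)).
by rewrite -modulus_dual_point// w0 modulus0.
Qed.

Lemma dual_pointZ p (a : R) w : 1 < p -> 0 <= a ->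
  dual_point p (of_real k a * w) = of_real k (a `^ (p - 1)) * dual_point p w.
Proof.
move=> p1 a0; rewrite /dual_point modulusM modulus_of_real ger0_norm//.
rewrite conj_realM powRM ?modulus_ge0// of_realM mulrACA; congr (_ * _).
rewrite -of_realM; congr (of_real _ _).
rewrite mulrC -(@mulr_powRB1 _ _ (p - 1)) ?subr_gt0//.
by congr (_ * _ `^ _); ring.
Qed.

Lemma re_mul_dual_le p z w : 1 < p ->
  re_part (z * dual_point p w) <= modulus z * modulus w `^ (p - 1).
Proof.
move=> p1; rewrite (le_trans (re_part_le_modulus _))// modulusM.
by rewrite modulus_dual_point.
Qed.

(** The Bregman divergence of |.| ^ p: the distance at z between |.| ^ p and
    its tangent at w. *)
Definition power_gap p z w : R :=
  modulus z `^ p + (p - 1) * modulus w `^ p -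
  p * re_part (z * dual_point p w).

Lemma power_gap_ge0 p z w : 1 < p -> 0 <= power_gap p z w.
Proof.
move=> p1; rewrite subr_ge0.
apply: le_trans (young_powR_le p1 (modulus_ge0 z) (modulus_ge0 w)).
by rewrite ler_pM2l ?re_mul_dual_le//; lra.
Qed.

(** Equality forces equality in [young_powR], hence |z| = |w|, and in
    Re (z conj w) <= |z| |w|, hence the same direction. *)
Lemma power_gap_eq0 p z w : 1 < p -> power_gap p z w = 0 -> z = w.
Proof.
move=> p1 /eqP; rewrite subr_eq0 => /eqP gap0.
have p0 : 0 < p by lra.
have zw : modulus z = modulus w.
  apply/eqP/negPn/negP => /(young_powR p1 (modulus_ge0 z) (modulus_ge0 w)).
  by rewrite gap0 ltr_pM2l// ltNge re_mul_dual_le.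
have [w0|wn0] := eqVneq w 0.
  by rewrite w0; apply: modulus0_eq0; rewrite zw w0 modulus0.
have re_zw : re_part (z * conj w) = modulus (z * conj w).
  move: gap0; rewrite zw -[X in X + _]mul1r -mulrDl addrC subrK.
  move=> /(mulfI (lt0r_neq0 p0)); rewrite /dual_point mulrCA re_partZ.
  have mw0 : 0 < modulus w.
    rewrite lt_neqAle modulus_ge0 andbT eq_sym; apply: contra_neq wn0.
    exact: modulus0_eq0.
  rewrite -(@mulr_powRB1 _ _ p) ?modulus_ge0// -powR_subr2// mulrCA.
  move/(mulfI (lt0r_neq0 (powR_gt0 _ mw0))) => <-.
  by rewrite modulusM modulus_conj zw.
have := re_part_eq_modulus re_zw.
rewrite modulusM modulus_conj zw -expr2 -mulr_conj => /mulIf; apply.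
apply: contra_neq wn0 => w0; apply: modulus0_eq0.
by rewrite -modulus_conj w0 modulus0.
Qed.

(** Unlike in [power_gap], the second factor is an arbitrary scalar, and the
    conjugate exponent p / (p - 1) appears. *)
Lemma young_dual p w c : 1 < p ->
  p * re_part (w * c) <=
  modulus w `^ p + (p - 1) * modulus c `^ (p / (p - 1)).
Proof.
move=> p1; have p10 : p - 1 != 0 by rewrite subr_eq0 gt_eqF.
have := young_powR_le p1 (modulus_ge0 w) (powR_ge0 (modulus c) (p - 1)^-1).
rewrite -!powRrM mulVf// powRr1 ?modulus_ge0// [_^-1 * p]mulrC.
apply: le_trans; rewrite ler_pM2l ?(lt_trans _ p1)// -modulusM.
exact: re_part_le_modulus.
Qed.

(* Concavity of s |-> s `^ (r / 2), applied to the squares of |z + w| and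
   |z - w|, whose mean is M by the parallelogram law.  Concavity is obtained
   from the convexity inequality [young_powR_le] for the inverse exponent. *)
Let clarkson_sub r z w : 0 < r < 2 -> z != 0 \/ w != 0 ->
  modulus (z + w) `^ r + modulus (z - w) `^ r <=
  2 * (modulus z ^+ 2 + modulus w ^+ 2) `^ (r / 2).
Proof.
move=> /andP[r0 r2] zw; pose P := 2 / r.
pose M := modulus z ^+ 2 + modulus w ^+ 2.
have P1 : 1 < P by rewrite ltr_pdivlMr ?mul1r.
have gt0 (y : K) : y != 0 -> 0 < modulus y ^+ 2.
  move=> y0; rewrite exprn_gt0// lt_neqAle modulus_ge0 andbT eq_sym.
  by apply: contra_neq y0; exact: modulus0_eq0.
have M0 : 0 < M.
  by rewrite /M; case: zw => /gt0 h; [rewrite ltr_pwDl// exprn_ge0 ?modulus_ge0|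
     rewrite ltr_pwDr// exprn_ge0 ?modulus_ge0].
pose b := M `^ (r / 2).
have b0 : 0 < b by rewrite powR_gt0.
have bP : b `^ P = M.
  rewrite /b -powRrM /P mulrA mulfVK ?pnatr_eq0// divff ?gt_eqF//.
  by rewrite powRr1// ltW.
have sq (y : K) : (modulus y `^ r) `^ P = modulus y ^+ 2.
  by rewrite -powRrM /P mulrCA divff ?gt_eqF// mulr1 powR_mulrn ?modulus_ge0.
have young (y : K) := young_powR_le P1 (powR_ge0 (modulus y) r) (ltW b0).
have := lerD (young (z + w)) (young (z - w)).
rewrite !sq addrACA modulus_parallelogram -/M bP.
rewrite -{2 3}bP -(@mulr_powRB1 _ b P) ?(ltW b0) ?(lt_trans _ P1)//.
rewrite -{1}bP -(@mulr_powRB1 _ b P) ?(ltW b0) ?(lt_trans _ P1)// -/b.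
have C0 : 0 < b `^ (P - 1) by rewrite powR_gt0.
set C := b `^ (P - 1) in C0 *; set X := modulus _ `^ r; set Y := modulus _ `^ r.
rewrite (_ : P * (X * C) + P * (Y * C) = P * C * (X + Y)); last by ring.
rewrite [leRHS](_ : _ = P * C * (2 * b)); last by ring.
by rewrite ler_pM2l// mulr_gt0// (lt_trans _ P1).
Qed.

(** The strictness, which comes from [powR_add_lt] alone, is what forces
    disjoint supports. *)
Lemma clarkson_lt r z w : 0 < r < 2 -> z != 0 -> w != 0 ->
  modulus (z + w) `^ r + modulus (z - w) `^ r <
  2 * (modulus z `^ r + modulus w `^ r).
Proof.
move=> r02 z0 w0; apply: le_lt_trans (clarkson_sub r02 (or_introl z0)) _.
have gt0 (y : K) : y != 0 -> 0 < modulus y.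
  move=> y0; rewrite lt_neqAle modulus_ge0 andbT eq_sym.
  by apply: contra_neq y0; exact: modulus0_eq0.
by rewrite ltr_pM2l// powR_add_lt ?gt0.
Qed.

Lemma clarkson_le r z w : 0 < r < 2 ->
  modulus (z + w) `^ r + modulus (z - w) `^ r <=
  2 * (modulus z `^ r + modulus w `^ r).
Proof.
move=> r02; have r0 : r != 0 by case/andP: r02 => r0 _; rewrite gt_eqF.
have [->|z0] := eqVneq z 0.
  by rewrite add0r sub0r modulusN modulus0 powR0// add0r mulr_natl mulr2n.
have [->|w0] := eqVneq w 0.
  by rewrite addr0 subr0 modulus0 powR0// addr0 mulr_natl mulr2n.
exact/ltW/clarkson_lt.
Qed.

End pointwise.

(** * Sums of real series *)

Section real_series.
Context {R : realType}.
Implicit Types (u v : nat -> R) (s t : R).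

Definition has_sum u s : Prop := (series u @ \oo --> s)%classic.

Lemma has_sum_unique {u s t} : has_sum u s -> has_sum u t -> s = t.
Proof. exact: cvg_unique. Qed.

Lemma has_sumD {u v s t} :
  has_sum u s -> has_sum v t -> has_sum (fun n => u n + v n) (s + t).
Proof.
move=> us vt; rewrite /has_sum [fun n => u n + v n](_ : _ = u + v)//.
by rewrite seriesD; exact: cvgD.
Qed.

Lemma has_sumZ {u s} (a : R) :
  has_sum u s -> has_sum (fun n => a * u n) (a * s).
Proof.
move=> us; rewrite /has_sum [fun n => a * u n](_ : _ = a *: u)//.
by rewrite seriesZ; exact: cvgZl_tmp.
Qed.

Lemma has_sum_bigsum {h : nat -> nat -> R} {t : nat -> R} N :
  (forall n, has_sum (h n) (t n)) ->
  has_sum (fun m => \sum_(n < N) h n m) (\sum_(n < N) t n).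
Proof.
move=> ht; elim: N => [|N IH].
  rewrite big_ord0 /has_sum [series _](_ : _ = cst 0); first exact: cvg_cst.
  by apply/funext => n; rewrite /series/= big1// => i _; rewrite big_ord0.
rewrite big_ord_recr/= (_ : (fun m => _) =
  (fun m => \sum_(n < N) h n m + h N m)); first exact: has_sumD.
by apply/funext => m; rewrite big_ord_recr.
Qed.

Lemma has_sum_ge_partial {u s} N : (forall n, 0 <= u n) -> has_sum u s ->
  series u N <= s.
Proof.
move=> u0 us; rewrite -(cvg_lim _ us)//; apply: nondecreasing_cvgn_le.
  by apply: nondecreasing_series => n _ _; exact: u0.
by apply/cvg_ex; exists s.
Qed.

Lemma has_sum_ge_term {u s} n : (forall n, 0 <= u n) -> has_sum u s -> u n <= s.
Proof.
move=> u0 us; apply: le_trans (has_sum_ge_partial n.+1 u0 us).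
rewrite seriesSr lerDr.
by apply: sumr_ge0 => i _; exact: u0.
Qed.

Lemma has_sum_ge0 {u s} : (forall n, 0 <= u n) -> has_sum u s -> 0 <= s.
Proof. by move=> u0 us; exact: le_trans (u0 0%N) (has_sum_ge_term 0 u0 us). Qed.

Lemma has_sum_le {u v s t} : (forall n, u n <= v n) ->
  has_sum u s -> has_sum v t -> s <= t.
Proof.
move=> uv us vt; rewrite -subr_ge0 -[- s]mulN1r.
apply: has_sum_ge0 (has_sumD vt (has_sumZ (-1) us)) => n.
by rewrite mulN1r subr_ge0.
Qed.

Lemma has_sum_single {u} n : (forall m, m != n -> u m = 0) -> has_sum u (u n).
Proof.
move=> u0; apply: cvg_near_cst; exists n.+1 => // N /= nN.
rewrite /series/= (@big_cat_nat _ _ _ n.+1)//= big_nat_recr//=.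
rewrite big_nat [X in X + _ + _]big1 ?add0r => [|i /andP[_ iN]]; last first.
  by apply: u0; rewrite ltn_eqF.
rewrite big_nat [X in _ + X]big1 ?addr0// => i /andP[ni _].
by apply: u0; rewrite gtn_eqF.
Qed.

Lemma has_sum_dominated {u v t} : (forall n, `|u n| <= v n) -> has_sum v t ->
  exists s, has_sum u s.
Proof.
move=> uv vt; apply/cvg_ex; apply: normed_cvg.
apply: (@series_le_cvg _ _ v) => //; last by apply/cvg_ex; exists t.
  by move=> n; exact: normr_ge0.
by move=> n; exact: le_trans (normr_ge0 _) (uv n).
Qed.

End real_series.

(** * The pairing on l_p *)

Section lp_pairing.
Context {R : realType} {k : scalar_kind} {p : R} {p1 : 1 < p}.
Local Notation K := (scalars R k).
Local Notation X := (lp k (ltW p1)).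
Implicit Types (x y z : X) (r : R) (a : K).

Let p_gt0 : 0 < p. Proof. exact: lt_trans p1. Qed.

Lemma lp_addE x y n : (x + y) n = x n + y n. Proof. by []. Qed.
Lemma lp_oppE x n : (- x) n = - x n. Proof. by []. Qed.
Lemma lp_scaleE a x n : (a *: x) n = a * x n. Proof. by []. Qed.

Lemma lpP {x y} : (forall n, x n = y n) -> x = y.
Proof. by move=> xy; apply: val_inj; apply/funext. Qed.

(** The p-th power of the norm is, unlike the norm, a sum over coordinates. *)
Definition power_norm x : R := lp_norm p x `^ p.

Lemma has_sum_power_norm x :
  has_sum (fun n => modulus (x n) `^ p) (power_norm x).
Proof.
have /asboolP cx := lp_seqP x.
rewrite /power_norm /lp_norm -powRrM mulVf ?gt_eqF// powRr1; first exact: cx.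
apply: has_sum_ge0 (cx : has_sum _ _) => n; exact: powR_ge0.
Qed.

Lemma lp_norm_ge0 x : 0 <= lp_norm p x. Proof. exact: powR_ge0. Qed.

Definition pairing x y : R :=
  limn (series (fun n => re_part (x n * dual_point p (y n)))).

Lemma has_sum_pairing x y :
  has_sum (fun n => re_part (x n * dual_point p (y n))) (pairing x y).
Proof.
suff [s sum_s] :
    exists s, has_sum (fun n => re_part (x n * dual_point p (y n))) s.
  by rewrite /pairing (cvg_lim _ sum_s); [exact: sum_s | exact: norm_hausdorff].
apply: has_sum_dominated (has_sumD (has_sum_power_norm x)
  (has_sumZ (p - 1) (has_sum_power_norm y))) => n.
rewrite (le_trans (normr_re_part _))// modulusM modulus_dual_point//.
apply: le_trans (young_powR_le p1 (modulus_ge0 _) (modulus_ge0 _)).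
by rewrite ler_peMl ?(ltW p1)// mulr_ge0 ?modulus_ge0 ?powR_ge0.
Qed.

Lemma pairing_sum {x y s} :
  has_sum (fun n => re_part (x n * dual_point p (y n))) s -> pairing x y = s.
Proof. exact: has_sum_unique (has_sum_pairing x y). Qed.

Lemma pairingDl x y z : pairing (x + y) z = pairing x z + pairing y z.
Proof.
apply: pairing_sum.
rewrite (_ : (fun n => _) = fun n => re_part (x n * dual_point p (z n)) +
  re_part (y n * dual_point p (z n))).
  exact: has_sumD (has_sum_pairing x z) (has_sum_pairing y z).
by apply/funext => n; rewrite lp_addE mulrDl re_partD.
Qed.

Lemma pairingZl r x y : pairing (of_real k r *: x) y = r * pairing x y.
Proof.
apply: pairing_sum.
rewrite (_ : (fun n => _) = fun n => r * re_part (x n * dual_point p (y n))).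
  exact: has_sumZ (has_sum_pairing x y).
by apply/funext => n; rewrite lp_scaleE -mulrA re_partZ.
Qed.

Lemma pairingNl x y : pairing (- x) y = - pairing x y.
Proof. by rewrite -scaleN1r -of_realN1 pairingZl mulN1r. Qed.

Lemma pairingBl x y z : pairing (x - y) z = pairing x z - pairing y z.
Proof. by rewrite pairingDl pairingNl. Qed.

Lemma pairing_self x : pairing x x = power_norm x.
Proof.
apply: pairing_sum; rewrite (_ : (fun n => _) = fun n => modulus (x n) `^ p).
  exact: has_sum_power_norm.
by apply/funext => n; rewrite re_mul_dual_self.
Qed.

Lemma has_sum_power_gap x y :
  has_sum (fun n => power_gap p (x n) (y n))
          (power_norm x + (p - 1) * power_norm y - p * pairing x y).
Proof.
rewrite -mulNr; apply: has_sumD; first apply: has_sumD.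
- exact: has_sum_power_norm.
- exact/has_sumZ/has_sum_power_norm.
- rewrite (_ : (fun n => _) =
    fun n => (- p) * re_part (x n * dual_point p (y n))).
    exact/has_sumZ/has_sum_pairing.
  by apply/funext => n; rewrite mulNr.
Qed.

Lemma pairing_young x y :
  p * pairing x y <= power_norm x + (p - 1) * power_norm y.
Proof.
rewrite -subr_ge0; apply: has_sum_ge0 (has_sum_power_gap x y) => n.
exact: power_gap_ge0.
Qed.

Lemma lp_norm_realZ r x : 0 <= r ->
  lp_norm p (of_real k r *: x) = r * lp_norm p x.
Proof.
move=> r0; have := lp_normZ (ltW p1) (of_real k r) (lp_seqP x).
by rewrite modulus_of_real ger0_norm.
Qed.

Lemma pairing_realZr r x y : 0 <= r ->
  pairing x (of_real k r *: y) = r `^ (p - 1) * pairing x y.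
Proof.
move=> r0; apply: pairing_sum; rewrite (_ : (fun n => _) =
  fun n => r `^ (p - 1) * re_part (x n * dual_point p (y n))).
  exact: has_sumZ (has_sum_pairing x y).
by apply/funext => n; rewrite lp_scaleE dual_pointZ// mulrCA re_partZ.
Qed.

(** Hoelder's inequality.  [pairing_young] is not homogeneous; scaling x by the
    norm of y and y by that of x gives both vectors the same norm, where it is
    sharp. *)
Lemma pairing_le x y :
  pairing x y <= lp_norm p x * lp_norm p y `^ (p - 1).
Proof.
have zero (z : X) : lp_norm p z = 0 -> z = 0.
  by move=> z0; apply: lpP => n; rewrite (lp_norm0_eq0 (lp_seqP z) z0).
have [az|an0] := eqVneq (lp_norm p x) 0.
  rewrite az mul0r (zero x az) -(scale0r (0 : X)) -(of_real0 R k).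
  by rewrite pairingZl mul0r.
have [bz|bn0] := eqVneq (lp_norm p y) 0.
  rewrite bz powR0 ?gt_eqF ?subr_gt0// mulr0 (zero y bz).
  rewrite -[X in pairing _ X](scale0r (0 : X)) -(of_real0 R k).
  by rewrite pairing_realZr// powR0 ?gt_eqF ?subr_gt0// mul0r.
have a0 : 0 < lp_norm p x by rewrite lt_neqAle eq_sym an0 lp_norm_ge0.
have b0 : 0 < lp_norm p y by rewrite lt_neqAle eq_sym bn0 lp_norm_ge0.
have := pairing_young (of_real k (lp_norm p y) *: x)
                      (of_real k (lp_norm p x) *: y).
rewrite pairingZl (pairing_realZr _ _ _ (ltW a0)) /power_norm.
rewrite (lp_norm_realZ _ _ (ltW a0)) (lp_norm_realZ _ _ (ltW b0)).
move: (lp_norm p x) (lp_norm p y) (pairing x y) a0 b0 {an0 bn0 zero}.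
move=> a b s a0 b0.
rewrite [a * b]mulrC.
rewrite [X in _ <= X -> _](_ : _ = p * (b * a) `^ p); last by ring.
rewrite ler_pM2l// (powRM _ (ltW b0) (ltW a0)) -(mulr_powRB1 (ltW a0) p_gt0).
rewrite -(mulr_powRB1 (ltW b0) p_gt0) => h.
have ba : 0 < b * a `^ (p - 1) by rewrite mulr_gt0 ?powR_gt0.
rewrite -(ler_pM2l ba) (le_trans _ (le_trans h _))//.
  by rewrite mulrA.
by rewrite le_eqVlt; apply/orP; left; apply/eqP; ring.
Qed.

End lp_pairing.

(** * Coordinate vectors and tails *)

Section coordinates.
Context {R : realType} {k : scalar_kind} {p : R} {p1 : 1 < p}.
Local Notation K := (scalars R k).
Local Notation X := (lp k (ltW p1)).
Implicit Types (x y z : X) (a : K).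

Let p_gt0 : 0 < p. Proof. exact: lt_trans p1. Qed.

Lemma power_norm_sum {x s} :
  has_sum (fun n => modulus (x n) `^ p) s -> power_norm x = s.
Proof. exact: has_sum_unique (has_sum_power_norm x). Qed.

Definition coordinate_seq n a : nat -> K := fun m => if m == n then a else 0.

Lemma coordinate_subproof n a : coordinate_seq n a \in lp_pred p.
Proof.
apply/asboolP/cvg_ex; exists (modulus (coordinate_seq n a n) `^ p).
apply: (has_sum_single n) => m /negPf mn.
by rewrite /coordinate_seq mn modulus0 powR0 ?gt_eqF.
Qed.

Definition coordinate n a : X := Lp (ltW p1) (coordinate_subproof n a).

Lemma coordinateE n a m : coordinate n a m = if m == n then a else 0.
Proof. by []. Qed.

Lemma power_norm_coordinate n a : power_norm (coordinate n a) = modulus a `^ p.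
Proof.
apply: power_norm_sum.
have := @has_sum_single _ (fun m => modulus (coordinate n a m) `^ p) n.
cbv beta; rewrite coordinateE eqxx; apply => m /negPf mn.
by rewrite coordinateE mn modulus0 powR0 ?gt_eqF.
Qed.

Lemma pairing_coordinatel n a y :
  pairing (coordinate n a) y = re_part (a * dual_point p (y n)).
Proof.
apply: pairing_sum.
have := @has_sum_single _
  (fun m => re_part (coordinate n a m * dual_point p (y m))) n.
cbv beta; rewrite coordinateE eqxx; apply => m /negPf mn.
by rewrite coordinateE mn mul0r -(of_real0 R k) re_part_of_real.
Qed.

Lemma pairing_coordinater n a x :
  pairing x (coordinate n a) = re_part (x n * dual_point p a).
Proof.
apply: pairing_sum.
have := @has_sum_single _
  (fun m => re_part (x m * dual_point p (coordinate n a m))) n.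
cbv beta; rewrite coordinateE eqxx; apply => m /negPf mn.
by rewrite coordinateE mn dual_point0 mulr0 -(of_real0 R k) re_part_of_real.
Qed.

(** Subtracting the coordinates one at a time makes every additive functional
    that kills coordinate vectors constant along the tails of x. *)
Fixpoint tail x N : X :=
  if N is M.+1 then tail x M - coordinate M (x M) else x.

Lemma tailE x N m : tail x N m = if (m < N)%N then 0 else x m.
Proof.
elim: N => // N IH; rewrite [tail x N.+1]/(tail x N - _).
rewrite lp_addE lp_oppE coordinateE IH ltnS.
by case: ltngtP => // [_|_|->]; rewrite ?subr0 ?subrr.
Qed.

Lemma power_norm_tail x N : power_norm (tail x N) =
  power_norm x - series (fun n => modulus (x n) `^ p) N.
Proof.
elim: N => [|N IH]; first by rewrite /series/= big_nil subr0.
rewrite seriesSr opprD addrA -IH; apply/eqP; rewrite eq_sym subr_eq; apply/eqP.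
apply: power_norm_sum.
rewrite -(power_norm_coordinate N (x N)) (_ : (fun n => _) = (fun n =>
  modulus (tail x N.+1 n) `^ p + modulus (coordinate N (x N) n) `^ p)).
  by apply: has_sumD; exact: has_sum_power_norm.
apply/funext => m; rewrite !tailE coordinateE ltnS.
by case: ltngtP => [_|_|->];
  rewrite modulus0 powR0 ?gt_eqF// ?addr0 ?add0r.
Qed.

Lemma small_tail x (e : R) : 0 < e -> exists N, lp_norm p (tail x N) < e.
Proof.
move=> e0; have /cvgrPdist_lt/(_ (e `^ p)) := has_sum_power_norm x.
rewrite powR_gt0// => /(_ isT)[N _ /(_ N (leqnn N))]/= h; exists N.
have {}h : power_norm (tail x N) < e `^ p.
  by rewrite power_norm_tail; apply: le_lt_trans h; exact: ler_norm.
rewrite ltNge; apply/negP => /(ge0_ler_powR (ltW p_gt0)).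
rewrite !nnegrE lp_norm_ge0 (ltW e0) => /(_ isT isT).
by rewrite leNgt h.
Qed.

(** Density of the finitely supported sequences: d x = d (tail x N), and the
    tails tend to 0.  A one-sided bound is enough, as d is odd. *)
Lemma functional_coordinate_eq0 (d : X -> R) (C : R) :
  (forall x y, d (x - y) = d x - d y) ->
  (forall n a, d (coordinate n a) = 0) ->
  (forall x, d x <= C * lp_norm p x) -> forall x, d x = 0.
Proof.
move=> dB d0 dC.
have dle x : d x <= 0.
  rewrite leNgt; apply/negP => dx0.
  have C1 : 0 < `|C| + 1 by rewrite ltr_wpDl.
  have [N xN] := small_tail x (d x / (`|C| + 1)) (divr_gt0 dx0 C1).
  have dt : d (tail x N) = d x.
    by elim: (N) => //= M IH; rewrite dB IH d0 subr0.
  have : d x <= `|C| * lp_norm p (tail x N).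
    rewrite -{1}dt (le_trans (dC _))// ler_wpM2r ?lp_norm_ge0 ?ler_norm//.
  apply/negP; rewrite -ltNge; move: xN; rewrite ltr_pdivlMr// => xN.
  apply: le_lt_trans xN; rewrite mulrC mulrDr mulr1 lerDl; exact: lp_norm_ge0.
move=> x; apply/eqP; rewrite eq_le dle/=.
by have := dle (0 - x); rewrite dB -(subrr x) dB subrr sub0r oppr_le0.
Qed.

End coordinates.

(** * Continuity of the duality map along a ray *)

Section dual_point_limit.
Context {R : realType} {k : scalar_kind}.
Local Notation K := (scalars R k).
Implicit Types (p : R) (w a : K).
Local Open Scope classical_set_scope.

(** At w = 0 the quantity is t `^ (p - 1) times a constant and 1 < p is used;
    elsewhere |.| `^ (p - 2) is continuous. *)
Lemma dual_point_right_limit p a w (c : R) : 1 < p ->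
  (forall t : R, 0 < t ->
    c <= re_part (a * dual_point p (w + of_real k t * a))) ->
  c <= re_part (a * dual_point p w).
Proof.
move=> p1 hc.
suff h : re_part (a * dual_point p (w + of_real k t * a)) @[t --> (0:R)^'+] -->
         re_part (a * dual_point p w).
  apply: (cvgr_to_ge h); near=> t; apply: hc.
  by near: t; exact: nbhs_right_gt.
have [->|w0] := eqVneq w 0.
  rewrite dual_point0 mulr0 -(of_real0 R k) re_part_of_real of_real0.
  have h : t `^ (p - 1) * re_part (a * dual_point p a) @[t --> (0:R)^'+]
      --> (0 : R).
    rewrite -[X in _ --> X](mul0r (re_part (a * dual_point p a))).
    by apply: cvgM; [apply: powR_cvg0; rewrite subr_gt0 | exact: cvg_cst].
  apply: cvg_trans h; apply: near_eq_cvg; near=> t.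
  have t0 : 0 <= t by apply: ltW; near: t; exact: nbhs_right_gt.
  by rewrite add0r dual_pointZ// [in RHS]mulrCA re_partZ.
have mw0 : 0 < modulus w.
  rewrite lt_neqAle modulus_ge0 andbT eq_sym; apply: contra_neq w0.
  exact: modulus0_eq0.
have id0 : (t : R) @[t --> (0:R)^'+] --> (0 : R) by exact: cvg_at_right_filter.
have modulus_cvg :
    modulus (w + of_real k t * a) @[t --> (0:R)^'+] --> modulus w.
  have a1 : 0 < modulus a + 1 by rewrite ltr_wpDl ?modulus_ge0.
  apply/cvgrPdist_le => e e0; near=> t.
  have t0 : 0 < t by near: t; exact: nbhs_right_gt.
  have h (u v : K) : modulus (u + v) - modulus u <= modulus v.
    by rewrite lerBlDl ler_modulusD.
  apply: (@le_trans _ _ (t * modulus a)).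
    have -> : t * modulus a = modulus (of_real k t * a).
      by rewrite modulusM modulus_of_real gtr0_norm.
    rewrite ler_norml andbC.
    have := h (w + of_real k t * a) (- (of_real k t * a)).
    rewrite addrK modulusN => ->/=; rewrite lerNl opprB; exact: h.
  have te : t < e / (modulus a + 1).
    by near: t; apply: nbhs_right_lt; rewrite divr_gt0.
  move: te; rewrite ltr_pdivlMr// => /ltW; apply: le_trans.
  by rewrite mulrDr lerDl mulr1 ltW.
have pow_cvg : modulus (w + of_real k t * a) `^ (p - 2) @[t --> (0:R)^'+] -->
    modulus w `^ (p - 2).
  have := @continuous_cvg _ _ _ _ _ (fun t : R => modulus (w + of_real k t * a))
    (fun s : R => s `^ (p - 2)) (modulus w) _ modulus_cvg.
  apply.
  apply: differentiable_continuous; apply/derivable1_diffP.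
  by apply: derivable_powR; rewrite in_itv/= mw0.
have lin_cvg : re_part (a * scalar_conj (w + of_real k t * a)) @[t --> (0:R)^'+]
    --> re_part (a * scalar_conj w).
  rewrite [X in _ --> X](_ : _ =
    re_part (a * scalar_conj w) + 0 * modulus a ^+ 2); last first.
    by rewrite mul0r addr0.
  rewrite (_ : (fun t => _) =
    fun t : R => re_part (a * scalar_conj w) + t * modulus a ^+ 2).
    by apply: cvgD; [exact: cvg_cst | apply: cvgM => //; exact: cvg_cst].
  apply/funext => t; rewrite conjD conj_realM mulrDr re_partD mulrCA mulr_conj.
  by rewrite re_partZ re_part_of_real.
rewrite /dual_point mulrCA re_partZ.
rewrite (_ : (fun t => _) = fun t : R =>
  modulus (w + of_real k t * a) `^ (p - 2) *
  re_part (a * scalar_conj (w + of_real k t * a))).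
  exact: cvgM.
by apply/funext => t; rewrite mulrCA re_partZ.
Unshelve. all: by end_near.
Qed.

End dual_point_limit.

(** * Smoothness of l_p and its semi-inner product *)

Section smoothness.
Context {R : realType} {k : scalar_kind} {p : R} {p1 : 1 < p}.
Local Notation K := (scalars R k).
Local Notation X := (lp k (ltW p1)).
Local Notation conj := (@scalar_conj R k).
Implicit Types (x y z : X) (a : K) (phi psi : X -> K).

Let p_gt0 : 0 < p. Proof. exact: lt_trans p1. Qed.

Lemma lp_norm_gt0 x : x != 0 -> 0 < lp_norm p x.
Proof.
move=> x0; rewrite lt_neqAle lp_norm_ge0 andbT eq_sym; apply: contra_neq x0.
by move=> x0; apply/normr0_eq0; rewrite lp_normE x0 of_real0.
Qed.

Lemma lp_norm_normalized x : x != 0 ->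
  lp_norm p (of_real k (lp_norm p x)^-1 *: x) = 1.
Proof.
move=> /lp_norm_gt0 x0; rewrite lp_norm_realZ ?invr_ge0 ?(ltW x0)//.
by rewrite mulVf// gt_eqF.
Qed.

Lemma scalarD phi x y : scalar phi -> phi (x + y) = phi x + phi y.
Proof. by move=> lphi; have := lphi 1 x y; rewrite scale1r mul1r. Qed.

Lemma scalar0 phi : scalar phi -> phi 0 = 0.
Proof.
by move=> lphi; have := scalarD phi 0 0 lphi; rewrite addr0 => /eqP;
  rewrite eq_sym -subr_eq0 addrK => /eqP.
Qed.

Lemma scalarZ phi a x : scalar phi -> phi (a *: x) = a * phi x.
Proof. by move=> lphi; have := lphi a x 0; rewrite !addr0 scalar0// addr0. Qed.

Lemma scalarB phi x y : scalar phi -> phi (x - y) = phi x - phi y.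
Proof. by move=> lphi; rewrite scalarD// -scaleN1r scalarZ// mulN1r. Qed.

Lemma scalar_ext phi psi : scalar phi -> scalar psi ->
  (forall x, re_part (phi x) = re_part (psi x)) -> phi = psi.
Proof.
move=> lphi lpsi pp; apply/funext => x; apply/eqP; rewrite -subr_eq0; apply/eqP.
apply: re_part_nondegenerate => w.
by rewrite mulrBr re_partD re_partN -!scalarZ// pp subrr.
Qed.

(** Rotate x by the conjugate of phi x to make the value real. *)
Lemma modulus_le_lp_norm phi : scalar phi ->
  (forall x, re_part (phi x) <= lp_norm p x) ->
  forall x, modulus (phi x) <= lp_norm p x.
Proof.
move=> lphi h x; have [->|m0] := eqVneq (modulus (phi x)) 0.
  exact: lp_norm_ge0.
have {}m0 : 0 < modulus (phi x) by rewrite lt_neqAle eq_sym m0 modulus_ge0.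
rewrite -(ler_pM2l m0) -expr2 -[_ ^+ 2](@re_part_of_real _ k) -mulr_conj mulrC.
rewrite -scalarZ// (le_trans (h _))//.
by rewrite (lp_normZ (ltW p1) _ (lp_seqP x)) modulus_conj.
Qed.

Lemma supporting_functional_of_le phi x : scalar phi ->
  (forall y, modulus (phi y) <= lp_norm p y) ->
  phi x = of_real k (lp_norm p x) -> x != 0 -> supporting_functional x phi.
Proof.
move=> lphi le_phi phix x0; split=> //; split=> [_ /= [y y1 <-]|b].
  rewrite -of_real_modulus -of_real1 ler_of_real (le_trans (le_phi _))//.
  by move: y1; rewrite /= lp_normE -of_real1 ler_of_real.
apply; exists (of_real k (lp_norm p x)^-1 *: x) => /=.
  by rewrite lp_normE lp_norm_normalized// of_real1.
rewrite scalarZ// phix -of_realM mulVf ?gt_eqF ?lp_norm_gt0//.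
by rewrite of_real1 normr1.
Qed.

Lemma supporting_functional_le phi x : supporting_functional x phi ->
  forall y, re_part (phi y) <= lp_norm p y.
Proof.
move=> [lphi [ub _] _] y; have [->|y0] := eqVneq y 0.
  by rewrite scalar0// -(of_real0 R k) re_part_of_real lp_norm_ge0.
have : re_part (phi (of_real k (lp_norm p y)^-1 *: y)) <= 1.
  rewrite (le_trans (re_part_le_modulus _))// -(ler_of_real k) of_real_modulus.
  rewrite of_real1; apply: ub => /=; eexists; last by [].
  by rewrite /= lp_normE lp_norm_normalized// of_real1.
by rewrite scalarZ// re_partZ mulrC ler_pdivrMr ?lp_norm_gt0// mul1r.
Qed.

(* The arithmetic of [supporting_functional_le_pairing]: c, N, n, W, m stand for
   ||x||^(p-1), ||x||^p, ||x||, ||x+ty||^p, ||x+ty||, then r for Re phi(y), and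
   A, B for the pairings of x, y with x + t y. *)
Let young_slopes (t c N n W m r A B : R) :
  0 < t -> 0 <= c -> n * c = N -> n + t * r <= m -> A + t * B = W ->
  p * A <= N + (p - 1) * W -> p * (m * c) <= W + (p - 1) * N -> c * r <= B.
Proof.
move=> t0 c0 nc nm AB pA pm.
have h : p * ((n + t * r) * c) <= p * (m * c).
  by rewrite ler_pM2l// ler_wpM2r.
have h' : p * (t * (c * r)) <= p * (t * B).
  rewrite -AB -nc in pA pm *; lra.
by move: h'; rewrite ler_pM2l// ler_pM2l.
Qed.

(** Difference quotients: phi lies below the norm and touches it at x, so
    t Re phi(y) is at most ||x + t y|| - ||x||; passing to p-th powers at both
    ends, the pairing with x + t y bounds the increment from above. *)
Lemma supporting_functional_le_pairing phi x y (t : R) :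
  supporting_functional x phi -> 0 < t ->
  lp_norm p x `^ (p - 1) * re_part (phi y) <= pairing y (x + of_real k t *: y).
Proof.
move=> sphi t0; set w := x + of_real k t *: y.
have [lphi _ phix] := sphi.
have phiw : lp_norm p x + t * re_part (phi y) <= lp_norm p w.
  have := supporting_functional_le _ _ sphi w.
  rewrite /w scalarD// scalarZ// phix lp_normE.
  by rewrite re_partD re_partZ re_part_of_real.
have pairw : pairing x w + t * pairing y w = power_norm w.
  by rewrite -pairing_self [in RHS]/w pairingDl pairingZl.
exact: (@young_slopes _ _ _ _ _ _ _ _ _ t0 (powR_ge0 _ _)
  (mulr_powRB1 (lp_norm_ge0 x) p_gt0) phiw pairw (pairing_young x w)
  (young_powR_le p1 (lp_norm_ge0 w) (lp_norm_ge0 x))).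
Qed.

(** The previous bound at a e_n, as t -> 0, is an inequality for every scalar
    a, hence an equality; then both sides agree by density. *)
Lemma supporting_functional_pairing phi x : supporting_functional x phi ->
  forall y, lp_norm p x `^ (p - 1) * re_part (phi y) = pairing y x.
Proof.
move=> sphi y; have [lphi _ _] := sphi.
apply/eqP; rewrite -subr_eq0; apply/eqP; move: y.
pose c := lp_norm p x `^ (p - 1).
apply: (@functional_coordinate_eq0 R k p p1
  (fun y => c * re_part (phi y) - pairing y x) (2 * c)).
- by move=> y z; rewrite scalarB// re_partD re_partN pairingBl; ring.
- have le n a : c * re_part (phi (coordinate n a)) <=
                re_part (a * dual_point p (x n)).
    rewrite -/c mulrC; apply: dual_point_right_limit => // t t0.
    have := supporting_functional_le_pairing _ _ (coordinate n a) _ sphi t0.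
    by rewrite pairing_coordinatel lp_addE lp_scaleE coordinateE eqxx mulrC.
  move=> n a; rewrite pairing_coordinatel.
  apply/eqP; rewrite subr_eq0 eq_le le/=.
  have coordN : coordinate n (- a) = - coordinate n a :> X.
    apply: lpP => m; rewrite lp_oppE !coordinateE.
    by case: ifP; rewrite ?oppr0.
  have := le n (- a); rewrite coordN mulNr re_partN -[- coordinate _ _]scaleN1r.
  by rewrite scalarZ// mulN1r re_partN mulrN lerN2.
- move=> y; have := supporting_functional_le _ _ sphi y.
  have := pairing_le (- y) x; rewrite pairingNl -/c.
  rewrite (_ : lp_norm p (- y) = lp_norm p y); last first.
    by have := normrN y; rewrite !lp_normE => /of_real_inj.
  have c0 : 0 <= c by exact: powR_ge0.
  move: c c0 (lp_norm p y) (re_part _) (pairing _ _) => c c0 n r s h1 h2; nra.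
Qed.

Lemma lp_smooth : smooth X.
Proof.
move=> x x0; have n0 := lp_norm_gt0 x x0.
have c0 : 0 < lp_norm p x `^ (p - 1) by rewrite powR_gt0.
have [y z|t y|phi lphi rephi] := @re_functional_extends R k X
  (fun y => pairing y x / lp_norm p x `^ (p - 1)).
- by rewrite pairingDl mulrDl.
- by rewrite pairingZl mulrA.
have le_phi : forall y, modulus (phi y) <= lp_norm p y.
  apply: (modulus_le_lp_norm _ lphi) => y.
  by rewrite rephi ler_pdivrMr ?pairing_le.
have rex : re_part (phi x) = lp_norm p x.
  rewrite rephi pairing_self /power_norm -(mulr_powRB1 (ltW n0) p_gt0) mulfK//.
  by rewrite gt_eqF.
have phix : modulus (phi x) = lp_norm p x.
  apply: le_anti; rewrite le_phi/= -[leLHS]rex; exact: re_part_le_modulus.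
exists phi; split=> [|psi spsi].
  apply: (supporting_functional_of_le _ _ lphi le_phi _ x0).
  by rewrite -phix; apply: re_part_eq_modulus; rewrite rex phix.
have [lpsi _ _] := spsi; apply: (scalar_ext _ _ lphi lpsi) => y.
rewrite rephi -(supporting_functional_pairing _ _ spsi) mulrC mulKf//.
by rewrite gt_eqF.
Qed.

(** By [sip_bound] and [sip_norm], s(., y) / ||y|| is a supporting functional
    at y, so [supporting_functional_pairing] computes it. *)
Lemma sip_pairing (s : X -> X -> K) : semi_inner_product conj s ->
  forall x y, pairing x y =
    lp_norm p y `^ (p - 1) / lp_norm p y * re_part (s x y).
Proof.
move=> sip x y; have [y0|y0] := eqVneq y 0.
  have ny : lp_norm p y = 0.
    have := normr0 X; rewrite -y0 lp_normE -{1}(of_real0 R k).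
    exact: of_real_inj.
  have -> : pairing x y = 0.
    rewrite y0 -[X in pairing _ X](scale0r (0 : X)) -(of_real0 R k).
    by rewrite pairing_realZr// powR0 ?gt_eqF ?subr_gt0// mul0r.
  by rewrite ny invr0 mulr0 mul0r.
have n0 := lp_norm_gt0 y y0.
pose phi z := s z y / of_real k (lp_norm p y).
have phiE z : phi z = of_real k (lp_norm p y)^-1 * s z y.
  have rn0 : of_real k (lp_norm p y) != 0.
    by rewrite -(of_real0 R k) (inj_eq (@of_real_inj R k)) gt_eqF.
  rewrite /phi; apply: (mulIf rn0); rewrite divfK// mulrAC -of_realM.
  by rewrite mulVf ?gt_eqF// of_real1 mul1r.
have sphi : supporting_functional y phi.
  apply: (supporting_functional_of_le _ _ _ _ _ y0).
  - move=> a u v; rewrite /phi -[v]scale1r (sip_linear sip) mul1r scale1r.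
    by rewrite mulrDl mulrA.
  - move=> z; have n0' : 0 <= (lp_norm p y)^-1 by rewrite invr_ge0 (ltW n0).
    rewrite phiE modulusM modulus_of_real (ger0_norm n0') mulrC ler_pdivrMr//.
    rewrite -(ler_of_real k) of_real_modulus of_realM.
    exact: sip_bound sip z y.
  - rewrite phiE (sip_norm sip) lp_normE expr2 -!of_realM mulrA mulVf ?gt_eqF//.
    by rewrite mul1r.
by rewrite -(supporting_functional_pairing _ _ sphi) phiE re_partZ mulrA.
Qed.

End smoothness.

(** * Disjointness of the images of the coordinate vectors *)

Section clarkson_equality.
Context {R : realType} {k : scalar_kind}.
Local Notation K := (scalars R k).

(** The nonnegative Clarkson defects of the U i and V i sum to 4 - A - B <= 0,
    so each of them is 0. *)
Lemma disjoint_of_clarkson {U V : nat -> K} {r A B : R} : 0 < r < 2 ->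
  has_sum (fun i => modulus (U i) `^ r) 1 ->
  has_sum (fun i => modulus (V i) `^ r) 1 ->
  has_sum (fun i => modulus (U i + V i) `^ r) A ->
  has_sum (fun i => modulus (U i - V i) `^ r) B ->
  2 <= A -> 2 <= B -> forall i, U i = 0 \/ V i = 0.
Proof.
move=> r02 sU sV sA sB A2 B2 i.
have sF := has_sumD (has_sumZ 2 (has_sumD sU sV))
  (has_sumZ (-1) (has_sumD sA sB)).
have [->|Ui] := eqVneq (U i) 0; first by left.
have [->|Vi] := eqVneq (V i) 0; first by right.
have F0 j : 0 <= 2 * (modulus (U j) `^ r + modulus (V j) `^ r) +
    -1 * (modulus (U j + V j) `^ r + modulus (U j - V j) `^ r).
  by rewrite mulN1r subr_ge0 clarkson_le.
have := has_sum_ge_term i F0 sF; have := clarkson_lt r02 Ui Vi.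
by move=> lt_i le_i; exfalso; lra.
Qed.

End clarkson_equality.

Section pairing_preservers.
Context {R : realType} {k : scalar_kind} {p : R} {p1 : 1 < p}.
Local Notation K := (scalars R k).
Local Notation X := (lp k (ltW p1)).
Implicit Types (x y z : X) (a b : K).
Variable f : X -> X.
Hypothesis f_pairing :
  forall a b x y, pairing (a *: f x) (b *: f y) = pairing (a *: x) (b *: y).

Let p_gt0 : 0 < p. Proof. exact: lt_trans p1. Qed.
Local Notation e n := (coordinate n 1 : X).

Let f_pairingl a x y : pairing (a *: f x) (f y) = pairing (a *: x) y.
Proof. by have := f_pairing a 1 x y; rewrite !scale1r. Qed.

Let f_pairingr b x y : pairing (f x) (b *: f y) = pairing x (b *: y).
Proof. by have := f_pairing 1 b x y; rewrite !scale1r. Qed.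

Let f_power_norm x : power_norm (f x) = power_norm x.
Proof.
by rewrite -!pairing_self; have := f_pairing 1 1 x x; rewrite !scale1r.
Qed.

Lemma scale_coordinate a n : a *: e n = coordinate n a.
Proof.
apply: lpP => m; rewrite lp_scaleE !coordinateE.
by case: ifP; rewrite ?mulr1 ?mulr0.
Qed.

Lemma coordinate_self a n : (coordinate n a : X) n = a.
Proof. by rewrite coordinateE eqxx. Qed.

Let modulus1 : modulus (1 : K) = 1.
Proof. by rewrite -(of_real1 (k := k)) modulus_of_real normr1. Qed.

Section pair_of_coordinates.
Variables (n m : nat) (nm : n != m) (a : K) (a1 : modulus a = 1).

(* The scalar a is 1 or -1 in the applications; keeping it general treats the
   sum and the difference at once. *)
Let pairing_sum_n : pairing (e n + a *: e m) (e n) = 1.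
Proof.
rewrite scale_coordinate pairing_coordinater lp_addE coordinate_self.
rewrite coordinateE (negPf nm) addr0.
by rewrite re_mul_dual_self// modulus1 powR1.
Qed.

Let pairing_sum_m : pairing (e n + a *: e m) (a *: e m) = 1.
Proof.
rewrite scale_coordinate pairing_coordinater lp_addE coordinate_self.
rewrite coordinateE eq_sym (negPf nm) add0r.
by rewrite re_mul_dual_self// a1 powR1.
Qed.

Let power_norm_sum2 : power_norm (e n + a *: e m) = 2.
Proof.
rewrite -pairing_self pairingDl scale_coordinate !pairing_coordinatel.
rewrite !lp_addE !coordinate_self !coordinateE (negPf nm) eq_sym (negPf nm).
by rewrite addr0 add0r !re_mul_dual_self// modulus1 a1 powR1.
Qed.

Let pairing_image_n : pairing (f (e n + a *: e m)) (f (e n)) = 1.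
Proof.
by have := f_pairingr 1 (e n + a *: e m) (e n); rewrite !scale1r pairing_sum_n.
Qed.

Let pairing_image_m : pairing (f (e n + a *: e m)) (a *: f (e m)) = 1.
Proof. by rewrite f_pairingr pairing_sum_m. Qed.

(** The vector f(e_n + a e_m), of p-th power norm 2, pairs to 2 with
    f(e_n) + a f(e_m); [pairing_young] then bounds the latter from below. *)
Lemma power_norm_image_ge2 : 2 <= power_norm (f (e n) + a *: f (e m)).
Proof.
have := pairing_young (f (e n) + a *: f (e m)) (f (e n + a *: e m)).
rewrite f_power_norm power_norm_sum2 pairingDl f_pairingl.
have -> : pairing (f (e n)) (f (e n + a *: e m)) =
          pairing (e n) (e n + a *: e m).
  by have := f_pairingl 1 (e n) (e n + a *: e m); rewrite !scale1r.
rewrite -pairingDl pairing_self power_norm_sum2; lra.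
Qed.

(** The mirror image of [power_norm_image_ge2]: the same vector is now paired
    on the left, and [young_dual] replaces [pairing_young]. *)
Lemma dual_image_ge2 (A : R) :
  has_sum (fun i => modulus (dual_point p (f (e n) i) +
    dual_point p ((a *: f (e m)) i)) `^ (p / (p - 1))) A -> 2 <= A.
Proof.
move=> sA; set w := f (e n + a *: e m).
have sl := has_sumZ p (has_sumD (has_sum_pairing w (f (e n)))
  (has_sum_pairing w (a *: f (e m)))).
have sr := has_sumD (has_sum_power_norm w) (has_sumZ (p - 1) sA).
rewrite pairing_image_n pairing_image_m in sl.
rewrite f_power_norm power_norm_sum2 in sr.
have : p * (1 + 1) <= 2 + (p - 1) * A.
  by apply: has_sum_le sl sr => i; rewrite -re_partD -mulrDr young_dual.
move=> h; have : (p - 1) * 2 <= (p - 1) * A by lra.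
by rewrite ler_pM2l// subr_gt0.
Qed.

End pair_of_coordinates.

Let modulusN1 : modulus (-1 : K) = 1.
Proof. by rewrite modulusN modulus1. Qed.

Let image_power_norm1 n : power_norm (f (e n)) = 1.
Proof. by rewrite f_power_norm power_norm_coordinate modulus1 powR1. Qed.

Let has_sum_image1 n : has_sum (fun i => modulus (f (e n) i) `^ p) 1.
Proof. by have := has_sum_power_norm (f (e n)); rewrite image_power_norm1. Qed.

Lemma disjoint_images_lt2 n m : p < 2 -> n != m ->
  forall i, f (e n) i = 0 \/ f (e m) i = 0.
Proof.
move=> p2 nm.
apply: (@disjoint_of_clarkson _ _ (f (e n)) (f (e m)) p
  (power_norm (f (e n) + 1 *: f (e m)))
  (power_norm (f (e n) + (-1) *: f (e m)))).
- by rewrite p_gt0.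
- exact: has_sum_image1.
- exact: has_sum_image1.
- by rewrite scale1r; exact: has_sum_power_norm.
- by rewrite scaleN1r; exact: has_sum_power_norm.
- exact: power_norm_image_ge2.
- exact: power_norm_image_ge2.
Qed.

Lemma disjoint_images_gt2 n m : 2 < p -> n != m ->
  forall i, f (e n) i = 0 \/ f (e m) i = 0.
Proof.
move=> p2 nm i.
have q02 : 0 < p / (p - 1) < 2.
  rewrite divr_gt0 ?subr_gt0//= ltr_pdivrMr ?subr_gt0//; lra.
have sdual j : has_sum
    (fun i => modulus (dual_point p (f (e j) i)) `^ (p / (p - 1))) 1.
  rewrite (_ : (fun i => _) = fun i => modulus (f (e j) i) `^ p).
    exact: has_sum_image1.
  apply/funext => l; rewrite modulus_dual_point// -powRrM; congr (_ `^ _).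
  by rewrite mulrCA divff ?mulr1// gt_eqF// subr_gt0.
pose U i := dual_point p (f (e n) i); pose V i := dual_point p (f (e m) i).
have sbound := has_sumZ 2 (has_sumD (sdual n) (sdual m)).
have [A sA] : exists A,
    has_sum (fun i => modulus (U i + V i) `^ (p / (p - 1))) A.
  apply: has_sum_dominated sbound => l; rewrite ger0_norm ?powR_ge0//.
  by apply: le_trans (clarkson_le _ _ q02); rewrite lerDl powR_ge0.
have [B sB] : exists B,
    has_sum (fun i => modulus (U i - V i) `^ (p / (p - 1))) B.
  apply: has_sum_dominated sbound => l; rewrite ger0_norm ?powR_ge0//.
  by apply: le_trans (clarkson_le _ _ q02); rewrite lerDr powR_ge0.
have A2 : 2 <= A.
  by apply: (dual_image_ge2 _ _ nm 1 modulus1); rewrite scale1r.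
have B2 : 2 <= B.
  apply: (dual_image_ge2 _ _ nm (-1) modulusN1).
  rewrite (_ : (fun i => _) = fun i => modulus (U i - V i) `^ (p / (p - 1)))//.
  by apply/funext => l; rewrite scaleN1r lp_oppE dual_pointN.
by case: (disjoint_of_clarkson q02 (sdual n) (sdual m) sA sB A2 B2 i)
  => /(dual_point_eq0 p1); [left|right].
Qed.

(** * Reconstruction of a preserver from its values on coordinate vectors *)

Section disjoint_images.
Hypothesis disjoint_images :
  forall n m, n != m -> forall i, f (e n) i = 0 \/ f (e m) i = 0.
Variable x : X.

(* [h n i] is the gap between f x i and x n * f (e n) i without its first
   summand, and vanishes off the support of f (e n).  By disjointness [gap N i]
   is therefore one single gap if i lies in the support of some f (e n), n < N,
   and modulus (f x i) `^ p otherwise. *)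
Let h n i : R :=
  (p - 1) * modulus (x n * f (e n) i) `^ p -
  p * re_part (f x i * dual_point p (x n * f (e n) i)).

Let gap N i : R := modulus (f x i) `^ p + \sum_(n < N) h n i.

Let h0 n i : f (e n) i = 0 -> h n i = 0.
Proof.
move=> fi0; rewrite /h fi0 mulr0 modulus0 powR0 ?gt_eqF// dual_point0 !mulr0.
by rewrite -(of_real0 R k) re_part_of_real mulr0 subrr.
Qed.

Let has_sum_h n : has_sum (h n) (- modulus (x n) `^ p).
Proof.
have sp : power_norm (x n *: f (e n)) = modulus (x n) `^ p.
  rewrite -pairing_self f_pairing scale_coordinate pairing_self.
  exact: power_norm_coordinate.
have sq : pairing (f x) (x n *: f (e n)) = modulus (x n) `^ p.
  by rewrite f_pairingr scale_coordinate pairing_coordinater re_mul_dual_self.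
rewrite (_ : - _ = (p - 1) * power_norm (x n *: f (e n)) +
    (- p) * pairing (f x) (x n *: f (e n))); last by rewrite sp sq; ring.
rewrite (_ : h n = fun i => (p - 1) * modulus ((x n *: f (e n)) i) `^ p +
  (- p) * re_part (f x i * dual_point p ((x n *: f (e n)) i))).
  exact: has_sumD (has_sumZ _ (has_sum_power_norm _))
                  (has_sumZ _ (has_sum_pairing _ _)).
by apply/funext => i; rewrite /h mulNr.
Qed.

Let has_sum_gap N : has_sum (gap N)
  (power_norm x - series (fun n => modulus (x n) `^ p) N).
Proof.
rewrite -f_power_norm (_ : - _ = \sum_(n < N) - modulus (x n) `^ p).
  exact: has_sumD (has_sum_power_norm _) (has_sum_bigsum _ has_sum_h).
by rewrite sumrN /series/= big_mkord.
Qed.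

Let gapE N n i : (n < N)%N -> f (e n) i != 0 ->
  gap N i = power_gap p (f x i) (x n * f (e n) i).
Proof.
move=> nN fi0; rewrite /gap (bigD1 (Ordinal nN))//= big1 => [|j].
  by rewrite addr0 /h addrA.
rewrite -val_eqE/= eq_sym => nj; apply: h0.
by case: (disjoint_images _ _ nj i) => // /eqP; rewrite (negPf fi0).
Qed.

Let gapE0 N i : (forall n, (n < N)%N -> f (e n) i = 0) ->
  gap N i = modulus (f x i) `^ p.
Proof. by move=> fi0; rewrite /gap big1 ?addr0// => j _; exact/h0/fi0. Qed.

Let gap_ge0 N i : 0 <= gap N i.
Proof.
have [[n fn0]|none] := pselect (exists n : 'I_N, f (e n) i != 0).
  by rewrite (gapE _ _ _ (ltn_ord n) fn0) power_gap_ge0.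
rewrite gapE0 ?powR_ge0// => n nN; apply/eqP/negPn/negP => fn0.
by apply: none; exists (Ordinal nN).
Qed.

(* A coordinate at which the gap is eventually constant: it is bounded by the
   total, which tends to 0. *)
Let gap_le0 n0 i (c : R) : (forall N, (n0 < N)%N -> gap N i = c) -> c <= 0.
Proof.
move=> gc; rewrite -(lerD2l (power_norm x)) addr0 -lerBrDr.
apply: (cvgr_to_le (has_sum_power_norm x)).
exists n0.+1 => // N /= nN; rewrite lerBrDr -lerBrDl -(gc N nN).
exact: has_sum_ge_term i (gap_ge0 N) (has_sum_gap N).
Qed.

Lemma image_on_support n i : f (e n) i != 0 -> f x i = x n * f (e n) i.
Proof.
move=> fn0; apply: (power_gap_eq0 p1); apply/eqP; rewrite eq_le.
rewrite power_gap_ge0// andbT; apply: (gap_le0 n i) => N nN; exact: gapE.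
Qed.

Lemma image_off_support i : (forall n, f (e n) i = 0) -> f x i = 0.
Proof.
move=> fn0; apply: modulus0_eq0; apply: (@powR_eq0_eq0 _ _ p).
apply/eqP; rewrite eq_le powR_ge0 andbT; apply: (gap_le0 0 i) => N _.
exact: gapE0.
Qed.

End disjoint_images.

Lemma linear_of_disjoint_images :
  (forall n m, n != m -> forall i, f (e n) i = 0 \/ f (e m) i = 0) -> linear f.
Proof.
move=> disj a x y; apply: lpP => i; rewrite lp_addE lp_scaleE.
have [[n fn0]|none] := pselect (exists n, f (e n) i != 0).
  have on z := image_on_support disj z n i fn0.
  by rewrite (on (a *: x + y)) (on x) (on y) lp_addE lp_scaleE mulrDl mulrA.
have off n : f (e n) i = 0.
  by apply/eqP/negPn/negP => fn0; apply: none; exists n.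
have {}off z := image_off_support disj z i off.
by rewrite (off (a *: x + y)) (off x) (off y) mulr0 addr0.
Qed.

(** * The exponent 2, and preservers of the semi-inner product *)

(** For p = 2 the duality map is conjugation, so the pairing is biadditive. *)
Lemma linear_of_p2 : p = 2 -> linear f.
Proof.
move=> p2 a x y.
have dualD (z w : K) : dual_point p (z + w) = dual_point p z + dual_point p w.
  by rewrite /dual_point p2 subrr !powRr0 of_real1 !mul1r conjD.
have pairingDr (u z w : X) : pairing u (z + w) = pairing u z + pairing u w.
  apply: pairing_sum; rewrite (_ : (fun n => _) = fun n =>
    re_part (u n * dual_point p (z n)) + re_part (u n * dual_point p (w n))).
    exact: has_sumD (has_sum_pairing _ _) (has_sum_pairing _ _).
  by apply/funext => n; rewrite lp_addE dualD mulrDr re_partD.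
pose u := 1 *: f (a *: x + y) + ((- a) *: f x + (-1) *: f y).
have u_orth b z : pairing u (b *: f z) = 0.
  rewrite !pairingDl !f_pairing -!pairingDl scale1r scaleNr scaleN1r.
  rewrite -opprD subrr -(scale0r (0 : X)) -(of_real0 R k).
  by rewrite pairingZl mul0r.
have u0 : power_norm u = 0.
  by rewrite -pairing_self {2}/u !pairingDr !u_orth !addr0.
apply/eqP; rewrite -subr_eq0; apply/eqP.
have -> : f (a *: x + y) - (a *: f x + f y) = u.
  by rewrite /u scale1r scaleNr scaleN1r opprD.
apply: lpP => i; apply: modulus0_eq0; apply: (@powR_eq0_eq0 _ _ p).
apply/eqP; rewrite eq_le powR_ge0 andbT -u0.
apply: has_sum_ge_term i _ (has_sum_power_norm u) => n; exact: powR_ge0.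
Qed.

Lemma linear_of_preserves_pairing : linear f.
Proof.
have [p2|p2|p2] := ltgtP p 2.
- by apply: linear_of_disjoint_images => n m; exact: disjoint_images_lt2.
- by apply: linear_of_disjoint_images => n m; exact: disjoint_images_gt2.
- exact: linear_of_p2.
Qed.

End pairing_preservers.

Section sip_preservers.
Context {R : realType} {k : scalar_kind} {p : R} {p1 : 1 < p}.
Local Notation K := (scalars R k).
Local Notation X := (lp k (ltW p1)).
Local Notation conj := (@scalar_conj R k).

(** The factor between s and the pairing only depends on the norm of the second
    argument, and f preserves norms because s u u is the squared norm. *)
Lemma sip_preserver_pairing (s : X -> X -> K) (f : X -> X) :
  semi_inner_product conj s -> (forall x y, s (f x) (f y) = s x y) ->
  forall a b x y, pairing (a *: f x) (b *: f y) = pairing (a *: x) (b *: y).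
Proof.
move=> sip fs a b x y.
have sZ c d u v : s (c *: u) (d *: v) = conj d * (c * s u v).
  rewrite (sip_conj sip); congr (_ * _).
  by have := sip_linear sip c 0 u 0 v; rewrite scale0r addr0 mul0r addr0.
have sqr_inj (r t : R) : 0 <= r -> 0 <= t ->
    of_real k r ^+ 2 = of_real k t ^+ 2 -> r = t.
  move=> r0 t0; rewrite !expr2 -!of_realM => /of_real_inj/eqP.
  by rewrite -!expr2 eqrXn2// => /eqP.
have norm_f u : lp_norm p (f u) = lp_norm p u.
  have := sip_norm sip (f u); rewrite fs (sip_norm sip) !lp_normE => h.
  exact: sqr_inj (lp_norm_ge0 _) (lp_norm_ge0 _) (esym h).
rewrite !(sip_pairing _ sip) !sZ fs.
have normZ c u : lp_norm p (c *: u : X) = modulus c * lp_norm p u.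
  by have := lp_normZ (ltW p1) c (lp_seqP u).
by rewrite !normZ norm_f.
Qed.

End sip_preservers.

Theorem theorem1p3 (R : realType) (k : scalar_kind) (p : R) (hp : 1 < p) :
  property_SL (@scalar_conj R k) (lp k (ltW hp)).
Proof.
split; first exact: lp_smooth.
move=> s sip f fs; apply: linear_of_preserves_pairing.
exact: sip_preserver_pairing sip fs.
Qed.
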